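(* Let $z\in\mathbb{C}\setminus\partial\mathbb{D}$. Then the functions $M_{\ell,\ell'}(\cdot,k)$, $\ell,\ell'\in\{0,1\}$, and $M_\pm(\cdot,k)$, $k\in\mathbb{Z}$, satisfy the following relations: $$M_{0,0}(z,k)=1+\frac{[\overline{a_k}-\overline{b_k}M_+(z,k)][a_k+b_kM_-(z,k)]}{\rho_k^2[M_+(z,k)-M_-(z,k)]},$$ $$M_{1,1}(z,k)=\frac{1-M_+(z,k)M_-(z,k)}{M_+(z,k)-M_-(z,k)},$$ $$M_{0,1}(z,k)=\frac{-1}{\rho_k[M_+(z,k)-M_-(z,k)]}\begin{cases}[1-M_+(z,k)][\overline{a_k}-\overline{b_k}M_-(z,k)],&k\text{ odd},\\ [1+M_+(z,k)][a_k+b_kM_-(z,k)],&k\text{ even},\end{cases}$$ $$M_{1,0}(z,k)=\frac{-1}{\rho_k[M_+(z,k)-M_-(z,k)]}\begin{cases}[1+M_+(z,k)][a_k+b_kM_-(z,k)],&k\text{ odd},\\ [1-M_+(z,k)][\overline{a_k}-\overline{b_k}M_-(z,k)],&k\text{ even}.\end{cases}$$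
   Context: $\mathbb{D}$ is the open unit disk in $\mathbb{C}$ and $\partial\mathbb{D}$ the unit circle. Let $\{\alpha_k\}_{k\in\mathbb{Z}}\subset\mathbb{D}$, $\rho_k=\sqrt{1-|\alpha_k|^2}$, $a_k=1+\alpha_k$, $b_k=1-\alpha_k$. Scalar products are linear in the second argument; $\{\delta_k\}$ is the standard basis of $\ell^2(\mathbb{Z})$; $[k_0,-\infty)\cap\mathbb{Z}$ means $(-\infty,k_0]\cap\mathbb{Z}$. CMV operator: $\theta_k=\begin{pmatrix}-\alpha_k&\rho_k\\ \rho_k&\overline{\alpha_k}\end{pmatrix}$. $V$ (resp. $W$) is the unitary operator on $\ell^2(\mathbb{Z})$ whose matrix in the standard basis is block diagonal with blocks $\theta_{2k}$ on rows/columns $2k-1,2k$ (resp. $\theta_{2k+1}$ on rows/columns $2k,2k+1$), $k\in\mathbb{Z}$, and $U=VW$. For $\ell,\ell'\in\{0,1\}$, $z\in\mathbb{C}\setminus\partial\mathbb{D}$, $k\in\mathbb{Z}$, $M_{\ell,\ell'}(z,k)=(\delta_{k-1+\ell},(U+zI)(U-zI)^{-1}\delta_{k-1+\ell'})_{\ell^2(\mathbb{Z})}$. For $z\in\mathbb{C}\setminus\{0\}$, put $T(z,k)=\frac1{\rho_k}\begin{pmatrix}\alpha_k&z\\1/z&\overline{\alpha_k}\end{pmatrix}$ for $k$ odd and $T(z,k)=\frac1{\rho_k}\begin{pmatrix}\overline{\alpha_k}&1\\1&\alpha_k\end{pmatrix}$ for $k$ even. The Laurent polynomials $p_+,r_+,q_+,s_+$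 (in $z$) are defined for all $k\in\mathbb{Z}$ by requiring that $(u,v)=(p_+,r_+)$ and $(u,v)=(q_+,s_+)$ solve $\binom{u(z,k,k_0)}{v(z,k,k_0)}=T(z,k)\binom{u(z,k-1,k_0)}{v(z,k-1,k_0)}$, $k\in\mathbb{Z}$, with initial values at $k=k_0$: $\binom{p_+}{r_+}=\binom{z}{1}$, $\binom{q_+}{s_+}=\binom{z}{-1}$ if $k_0$ is odd, and $\binom{p_+}{r_+}=\binom{1}{1}$, $\binom{q_+}{s_+}=\binom{-1}{1}$ if $k_0$ is even. For $z\in\mathbb{C}\setminus(\partial\mathbb{D}\cup\{0\})$, $M_\pm(z,k_0)$ are the unique complex numbers such that $\binom{q_+(z,\cdot,k_0)}{s_+(z,\cdot,k_0)}+M_\pm(z,k_0)\binom{p_+(z,\cdot,k_0)}{r_+(z,\cdot,k_0)}\in\ell^2([k_0,\pm\infty)\cap\mathbb{Z})^2$; they are extended to $z=0$ by analyticity, with values $M_+(0,k_0)=1$ and $M_-(0,k_0)=(\alpha_{k_0}+1)/(\alpha_{k_0}-1)$. *)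

(* Defs.v *)
From mathcomp Require Import all_boot all_order all_algebra.
From mathcomp Require Import complex zify ring.
From mathcomp Require Import boolp classical_sets reals ereal topology.
From mathcomp Require Import normedtype sequences esum.
Import Order.TTheory GRing.Theory Num.Theory.
Import ComplexField.Normc numFieldNormedType.Exports.
Set Implicit Arguments.
Unset Strict Implicit.
Unset Printing Implicit Defensive.
Local Open Scope classical_set_scope.
Local Open Scope ring_scope.

Definition oddz (k : int) : bool := odd `|k|%N.

Section Vectors2.
Variable R : realType.

Definition cv2 (u v : R[i]) : 'cV[R[i]]_2 :=
  \col_i (if i == 0 then u else v).

Definition mx2 (a b c d : R[i]) : 'M[R[i]]_2 :=
  \matrix_(i, j) if i == 0 then (if j == 0 then a else b)
                 else (if j == 0 then c else d).

Lemma mulmx_mx2 (a b c d a' b' c' d' : R[i]) :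
  mx2 a b c d *m mx2 a' b' c' d'
    = mx2 (a * a' + b * c') (a * b' + b * d') (c * a' + d * c') (c * b' + d * d').
Proof.
apply/matrixP => i j; rewrite !mxE !big_ord_recl big_ord0 !mxE /= addr0.
by do 2 case: ifP.
Qed.

Lemma mx2_1 : mx2 1 0 0 1 = 1%:M :> 'M[R[i]]_2.
Proof.
by apply/matrixP => -[[|[|?]] ?] [[|[|?]] ?] //; rewrite !mxE.
Qed.

End Vectors2.

Lemma climE (C : numClosedFieldType) (f : nat -> C) l :
  f n @[n --> \oo] --> l -> limn f = l.
Proof. by move=> h; apply: cvg_lim; [exact: norm_hausdorff|exact: h]. Qed.

Section Ell2.
Variable R : realType.
Implicit Types (f g : int -> R[i]) (k : int).

Definition ell2_on (D : set int) f : Prop :=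
  (\esum_(k in D) (normc (f k) ^+ 2)%:E < +oo)%E.

Definition ell2 f : Prop := ell2_on setT f.

(* The sum over all of Z is taken as the sum over n : nat of the terms of
   index n and -(n+1); for f and g in ell^2 it converges absolutely, so that
   the order of summation is irrelevant. *)
Definition ell2_dot f g : R[i] :=
  \big[+%R/0]_(0 <= n <oo)
    ((f n%:Z)^* * g n%:Z + (f (Negz n))^* * g (Negz n)).

Definition delta k : int -> R[i] := fun j => (j == k)%:R.

Lemma ell2_dot_delta j (g : int -> R[i]) : ell2_dot (delta j) g = g j.
Proof.
rewrite /ell2_dot.
apply: (@climE (R[i] : numClosedFieldType)).
set m := (absz j).+1.
apply: cvg_near_cst; exists m => // n /= hn.
rewrite /delta.
have E : forall a b : int, ((a == b)%:R : R[i])^* * g a = (a == b)%:R * g a.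
  by move=> a b; case: eqP; rewrite ?conjC0 ?conjC1.
under eq_bigr => i _ do rewrite !E.
case: j @m hn => p /= hn.
  rewrite (bigD1_seq p) /= ?iota_uniq ?mem_index_iota // eqxx mul1r mul0r addr0.
  rewrite big1 ?addr0 // => i ip; rewrite (_ : (_ == _) = false) ?mul0r ?addr0 //.
  by apply/negP => /eqP [] /eqP; rewrite (negbTE ip).
rewrite (bigD1_seq p) /= ?iota_uniq ?mem_index_iota //; last by move: hn; lia.
rewrite eqxx mul1r mul0r add0r.
rewrite big1 ?addr0 // => i ip; rewrite (_ : (Negz i == _) = false) ?mul0r ?addr0 //.
by apply/negP => /eqP [] /eqP; rewrite (negbTE ip).
Qed.

(* For A injective on ell^2 this is the inverse of A : ell^2 -> ell^2,
   at every f in its range. *)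
Definition ell2_inv (A : (int -> R[i]) -> (int -> R[i])) f : int -> R[i] :=
  xget (fun=> 0) [set g | ell2 g /\ A g = f].

End Ell2.

Section CMV.
Variables (R : realType) (alpha : int -> R[i]).
Implicit Types (f : int -> R[i]) (z m : R[i]) (j k : int).

Definition rho k : R[i] := (Num.sqrt (1 - normc (alpha k) ^+ 2))%:C%C.

Lemma rho_sqr k : normc (alpha k) < 1 ->
  rho k ^+ 2 = 1 - alpha k * (alpha k)^*.
Proof.
move=> h; rewrite /rho -rmorphXn /= sqr_sqrtr; last first.
  have h0 : 0 <= normc (alpha k) by case: (alpha k) => x y; exact: sqrtr_ge0.
  by rewrite subr_ge0 expr_le1 // ltW.
rewrite -normCK (_ : `|alpha k| = (normc (alpha k))%:C%C) //.
by rewrite -rmorphXn -[1 in RHS](rmorph1 (real_complex R)) -rmorphB.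
Qed.

Lemma rho_neq0 k : normc (alpha k) < 1 -> rho k != 0.
Proof.
move=> h; rewrite /rho fmorph_eq0 gt_eqF // sqrtr_gt0 subr_gt0.
have h0 : 0 <= normc (alpha k) by case: (alpha k) => x y; exact: sqrtr_ge0.
by rewrite -(expr1n _ 2) ltrXn2r.
Qed.

Definition theta k : 'M[R[i]]_2 :=
  mx2 (- alpha k) (rho k) (rho k) (alpha k)^*.

(* The operator with block theta_k on rows and columns k-1, k, for every k of
   parity b. Row j is the second row of the block theta_j if j has parity b,
   and the first row of the block theta_(j+1) otherwise. *)
Definition block_op (b : bool) f : int -> R[i] := fun j =>
  if oddz j == b then (theta j *m cv2 (f (j - 1)) (f j)) 1 0
  else (theta (j + 1) *m cv2 (f j) (f (j + 1))) 0 0.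

Definition opV : (int -> R[i]) -> (int -> R[i]) := block_op false.
Definition opW : (int -> R[i]) -> (int -> R[i]) := block_op true.
Definition opU f : int -> R[i] := opV (opW f).

Definition opU_shift z f : int -> R[i] := fun j => opU f j + z * f j.

Definition Mll (l l' : 'I_2) z k : R[i] :=
  ell2_dot (delta R (k - 1 + (l : nat)%:Z))
    (opU_shift z (ell2_inv (opU_shift (- z)) (delta R (k - 1 + (l' : nat)%:Z)))).

Definition transfer z k : 'M[R[i]]_2 :=
  (rho k)^-1 *: (if oddz k then mx2 (alpha k) z z^-1 (alpha k)^*
                 else mx2 (alpha k)^* 1 1 (alpha k)).

Lemma transfer_unit z k : normc (alpha k) < 1 -> z != 0 ->
  transfer z k \in unitmx.
Proof.
move=> h z0; have r0 := rho_neq0 h.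
set adj := (if oddz k then mx2 (- (alpha k)^*) z z^-1 (- alpha k)
            else mx2 (- alpha k) 1 1 (- (alpha k)^*)).
suff: transfer z k *m ((rho k)^-1 *: adj) = 1%:M.
  by case/mulmx1_unit.
rewrite /transfer -scalemxAl -scalemxAr scalerA -invfM -expr2 rho_sqr //.
have := expf_neq0 2 r0; rewrite rho_sqr // => d0.
rewrite /adj; case: ifP => _; rewrite mulmx_mx2 -mx2_1;
  apply/matrixP => i j; rewrite !mxE; case: ifP => _; case: ifP => _;
  field; rewrite ?z0 ?d0 //.
Qed.

(* The solution x of x k = transfer z k *m x (k - 1) on Z with x k0 = x0;
   see transfer_solE. *)
Fixpoint transfer_fwd z k0 (x0 : 'cV[R[i]]_2) (n : nat) : 'cV[R[i]]_2 :=
  if n is n'.+1 then transfer z (k0 + n'.+1%:Z) *m transfer_fwd z k0 x0 n'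
  else x0.

Fixpoint transfer_bwd z k0 (x0 : 'cV[R[i]]_2) (n : nat) : 'cV[R[i]]_2 :=
  if n is n'.+1 then
    invmx (transfer z (k0 - n'%:Z)) *m transfer_bwd z k0 x0 n'
  else x0.

Definition transfer_sol z k0 (x0 : 'cV[R[i]]_2) k : 'cV[R[i]]_2 :=
  match k - k0 with
  | Posz n => transfer_fwd z k0 x0 n
  | Negz n => transfer_bwd z k0 x0 n.+1
  end.

Lemma transfer_solE z k0 x0 :
  (forall k, normc (alpha k) < 1) -> z != 0 ->
  transfer_sol z k0 x0 k0 = x0 /\
  forall k, transfer_sol z k0 x0 k
    = transfer z k *m transfer_sol z k0 x0 (k - 1).
Proof.
move=> halpha z0; split=> [|k]; first by rewrite /transfer_sol subrr.
rewrite /transfer_sol addrAC; have := subrK k0 k.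
case: (k - k0) => [[|n]|n] <-.
- have -> : 0%N%:Z - 1 = Negz 0 by [].
  rewrite [RHS]/= subr0 add0r mulKVmx //; exact: transfer_unit.
- have -> : n.+1%:Z - 1 = n by lia.
  by rewrite [LHS]/= [k0 + _]addrC.
have -> : Negz n - 1 = Negz n.+1 by lia.
have -> : Negz n + k0 = k0 - n.+1%:Z by lia.
rewrite -[transfer_bwd _ _ _ n.+2]/(invmx (transfer z (k0 - n.+1%:Z)) *m
  transfer_bwd z k0 x0 n.+1).
by rewrite mulKVmx //; apply: transfer_unit.
Qed.

Definition pr_plus z k k0 : 'cV[R[i]]_2 :=
  transfer_sol z k0 (if oddz k0 then cv2 z 1 else cv2 1 1) k.

Definition qs_plus z k k0 : 'cV[R[i]]_2 :=
  transfer_sol z k0 (if oddz k0 then cv2 z (- 1) else cv2 (- 1) 1) k.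

Definition p_plus z k k0 : R[i] := pr_plus z k k0 0 0.
Definition r_plus z k k0 : R[i] := pr_plus z k k0 1 0.
Definition q_plus z k k0 : R[i] := qs_plus z k k0 0 0.
Definition s_plus z k k0 : R[i] := qs_plus z k k0 1 0.

Definition weyl_on (D : set int) z k0 m : Prop :=
  ell2_on D (fun k => q_plus z k k0 + m * p_plus z k k0) /\
  ell2_on D (fun k => s_plus z k k0 + m * r_plus z k k0).

(* For z off the unit circle and z != 0 there is exactly one m to choose. *)
Definition M_plus z k0 : R[i] :=
  if z == 0 then 1
  else xget 0 [set m | weyl_on [set k | k0 <= k] z k0 m].

Definition M_minus z k0 : R[i] :=
  if z == 0 then (alpha k0 + 1) / (alpha k0 - 1)
  else xget 0 [set m | weyl_on [set k | k <= k0] z k0 m].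

Definition ca k : R[i] := 1 + alpha k.
Definition cb k : R[i] := 1 - alpha k.

End CMV.

(* Main.v *)
(* A solution [u, v] of the transfer recursion is the same as a solution of
   [U u = z u] together with [v = W u / z]. Since the blocks [theta k] are
   unitary, the flux F_k = (-1)^k (|u_k|^2 - |v_k|^2) / (1 - |z|^2) is constant
   across even k and grows by |v_(k-1)|^2 + |v_k|^2 across odd k. Hence a nonzero
   solution has F < 0 everywhere if it is square summable at +oo, and F > 0
   everywhere if it is so at -oo; in particular [U - z] is injective on ell^2 and
   M_+ <> M_-. Solutions with F_n = 0 have F <= 0 up to n, and a cluster point of
   such normalized solutions as n -> +oo has F <= 0 everywhere, which makes it
   square summable at +oo; the reflection k -> -k gives the other end. These
   solutions are proportional to some q + m p, because p has F of the wrong sign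
   near k0 and is not square summable at either end. The kernel of (U - z)^-1 is
   then glued from the two Weyl solutions, and the formulas are its four entries
   near k. At z = 0 the inverse of U is explicit and M_(l,l') is the Kronecker
   delta. *)
Require Import Defs.
From mathcomp Require Import all_boot all_order all_algebra.
From mathcomp Require Import complex zify ring lra.
From mathcomp Require Import boolp classical_sets functions cardinality fsbigop.
From mathcomp Require Import reals ereal topology.
From mathcomp Require Import normedtype sequences esum.
Import Order.TTheory GRing.Theory Num.Theory.
Import ComplexField.Normc numFieldNormedType.Exports.
Local Open Scope ring_scope.

(** * Square summability *)

Section SquareNorm.
Context {R : realType}.
Implicit Types x y : R[i].

Definition normc2 x : R := normc x ^+ 2.

Lemma normc2E x : normc2 x = complex.Re x ^+ 2 + complex.Im x ^+ 2.
Proof. by case: x => a b; rewrite /normc2 /= sqr_sqrtr// addr_ge0 ?sqr_ge0. Qed.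

Lemma normc2_ge0 x : 0 <= normc2 x.
Proof. by rewrite normc2E addr_ge0 ?sqr_ge0. Qed.

Lemma normc2M x y : normc2 (x * y) = normc2 x * normc2 y.
Proof. by case: x y => [a b] [c d]; rewrite !normc2E /=; ring. Qed.

Lemma normc2_conj x : normc2 (x^*) = normc2 x.
Proof. by case: x => [a b]; rewrite !normc2E /=; ring. Qed.

Lemma normc2N x : normc2 (- x) = normc2 x.
Proof. by case: x => [a b]; rewrite !normc2E /=; ring. Qed.

Lemma normc2_0 : normc2 0 = 0.
Proof. by rewrite normc2E /= expr0n addr0. Qed.

Lemma normc2_1 : normc2 1 = 1.
Proof. by rewrite normc2E /= expr0n expr1n addr0. Qed.

Lemma normc2_eq0 x : (normc2 x == 0) = (x == 0).
Proof.
case: x => a b; rewrite normc2E /= paddr_eq0 ?sqr_ge0// !sqrf_eq0.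
by rewrite eq_complex.
Qed.

Lemma normc2D_le x y : normc2 (x + y) <= 2 * normc2 x + 2 * normc2 y.
Proof.
rewrite -subr_ge0 (_ : _ - _ = normc2 (x - y)) ?normc2_ge0//.
by case: x y => [a b] [c d]; rewrite !normc2E /=; ring.
Qed.

End SquareNorm.

Section SquareSummable.
Context {R : realType}.
Implicit Types (f g : int -> R[i]) (D : set int).

Let normc2_sum_ge0 f k : (0 <= (normc (f k) ^+ 2)%:E)%E.
Proof. by rewrite lee_fin normc2_ge0. Qed.

Lemma ell2_onS D D' f : (D' `<=` D)%classic -> ell2_on D f -> ell2_on D' f.
Proof.
move=> sub; apply: le_lt_trans; rewrite esum_mkcond [leRHS]esum_mkcond.
apply: le_esum => k _; case: ifPn => [|_]; last by case: ifP.
by move=> /set_mem/sub/mem_set ->.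
Qed.

Lemma eq_ell2_on D f g : (forall k, D k -> f k = g k) -> ell2_on D f -> ell2_on D g.
Proof. by move=> e; rewrite /ell2_on; under eq_esum => k Dk do rewrite e//. Qed.

Lemma ell2_onU D D' f : ell2_on D f -> ell2_on D' f -> ell2_on (D `|` D') f.
Proof.
move=> fD fD'; rewrite /ell2_on (esumID D)//.
apply: lte_add_pinfty.
  by apply: ell2_onS fD => k [].
by apply: ell2_onS fD' => k [[]].
Qed.

Lemma ell2_on_finite D f : finite_set D -> ell2_on D f.
Proof.
move=> fD; rewrite /ell2_on esum_fset//.
by rewrite fsumEFin// ltry.
Qed.

Lemma ell2_onZ D c f : ell2_on D f -> ell2_on D (fun k => c * f k).
Proof.
rewrite /ell2_on => fD.
have : ((normc2 c)%:E * (\esum_(k in D) (normc (f k) ^+ 2)%:E) < +oo)%E.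
  have ge0 : (0 <= \esum_(k in D) (normc (f k) ^+ 2)%:E)%E.
    by apply: esum_ge0 => *; exact: normc2_sum_ge0.
  by move: fD ge0; case: (esum D _) => // r _ _; rewrite -EFinM ltry.
apply: le_lt_trans; apply: ge_ereal_sup => _ [X [finX XD] <-].
under eq_fsbigr do rewrite -/(normc2 _) normc2M EFinM.
rewrite -ge0_mule_fsumr; last by move=> k; rewrite lee_fin normc2_ge0.
by apply: lee_wpmul2l; [rewrite lee_fin normc2_ge0|apply: esum_ge; exists X].
Qed.

Lemma ell2_onD D f g : ell2_on D f -> ell2_on D g -> ell2_on D (fun k => f k + g k).
Proof.
move=> fD gD; rewrite /ell2_on.
apply: (@le_lt_trans _ _ (\esum_(k in D) ((normc (f k) ^+ 2)%:E + (normc (f k) ^+ 2)%:E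
   + ((normc (g k) ^+ 2)%:E + (normc (g k) ^+ 2)%:E)))%E).
  apply: le_esum => k _; rewrite -!EFinD lee_fin.
  by apply: le_trans (normc2D_le _ _) _; rewrite /normc2 !mulr2n !mulrDl !mul1r.
rewrite !esumD; [|by move=> *; rewrite ?adde_ge0//..].
by rewrite !lte_add_pinfty.
Qed.

(** The extended-real sum is traded for bounded partial sums, the form that a telescoping flux
    estimate yields. *)
Lemma ell2_on_rightP k0 f : ell2_on [set k | k0 <= k]%classic f <->
  exists C, forall n : nat, \sum_(i < n) normc2 (f (k0 + i%:Z)) <= C.
Proof.
rewrite /ell2_on (_ : \esum_(k in _) _ = \sum_(i <oo) (normc2 (f (k0 + i%:Z)))%:E)%E; last first.
  rewrite nneseries_esumT; last by move=> n; rewrite lee_fin normc2_ge0.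
  rewrite (reindex_esum setT _ (fun i : nat => k0 + i%:Z))//; split.
  - by move=> i _ /=; lia.
  - by move=> i j _ _ /= ?; lia.
  - by move=> k /= hk; exists `|k - k0|%N => //; lia.
have ge0 i : true -> (0 <= (normc2 (f (k0 + i%:Z)))%:E)%E by rewrite lee_fin normc2_ge0.
split=> [fin|[C hC]].
  exists (fine (\sum_(i <oo) (normc2 (f (k0 + i%:Z)))%:E)%E) => n.
  rewrite -lee_fin fineK; last by rewrite ge0_fin_numE// nneseries_ge0// => *; exact: ge0.
  rewrite -sumEFin -(big_mkord xpredT (fun i => (normc2 (f (k0 + i%:Z)))%:E)).
  by apply: nneseries_lim_ge => i *; exact: ge0.
apply: (@le_lt_trans _ _ C%:E); last exact: ltry.
apply: lime_le.
  by apply: is_cvg_nneseries => i *; exact: ge0.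
by apply: nearW => n; rewrite big_mkord sumEFin lee_fin.
Qed.

Lemma ell2_on_right_cvg0 k0 f (e : R) : 0 < e -> ell2_on [set k | k0 <= k]%classic f ->
  exists K, forall k, K <= k -> normc2 (f k) < e.
Proof.
move=> e0 /ell2_on_rightP [C hC].
have : cvgn (series (fun i : nat => normc2 (f (k0 + i%:Z)))).
  apply: nondecreasing_is_cvgn; first by apply: nondecreasing_series => *; exact: normc2_ge0.
  by exists C => _ [n _ <-]; rewrite /series /= big_mkord.
move=> /cvg_series_cvg_0 /cvgrPdist_lt /(_ _ e0) [N _ hN].
exists (k0 + N%:Z) => k hk.
have := hN `|k - k0|%N; rewrite /= sub0r normrN.
rewrite (_ : k0 + `|k - k0|%N = k); last by lia.
by rewrite ger0_norm ?normc2_ge0//; apply; lia.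
Qed.

(** The map [k -> - k - 1] sends the pair [k - 1], [k] to [- k], [- k - 1], so that a step of the
    recursion becomes a reversed step of the same parity. *)
Lemma ell2_on_reflect k0 f : ell2_on [set k | k <= k0]%classic f <->
  ell2_on [set k | - k0 - 1 <= k]%classic (fun k => f (- k - 1)).
Proof.
rewrite /ell2_on (reindex_esum [set k | - k0 - 1 <= k]%classic _ (fun k => - k - 1))//; split.
- by move=> i /=; lia.
- by move=> i j _ _ /= ?; lia.
- by move=> k /= hk; exists (- k - 1); lia.
Qed.

(** Moving the end point of a half-line adds at most finitely many indices. *)
Lemma ell2_on_right_shift k0 k1 f :
  ell2_on [set k | k0 <= k]%classic f -> ell2_on [set k | k1 <= k]%classic f.
Proof.
move=> fk0.
apply: (@ell2_onS ([set k | k0 <= k] `|` (fun i : nat => k1 + i%:Z) @` `I_(`|k0 - k1|))%classic).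
  move=> k /= k1k; have [|] := leP k0 k; [by left|right].
  by exists `|k - k1|%N => /=; lia.
by apply: ell2_onU => //; apply: ell2_on_finite; exact/finite_image/finite_II.
Qed.

Lemma ell2_on_left_shift k0 k1 f :
  ell2_on [set k | k <= k0]%classic f -> ell2_on [set k | k <= k1]%classic f.
Proof. by rewrite !ell2_on_reflect; exact: ell2_on_right_shift. Qed.

Lemma ell2_right_left k0 k1 f : ell2_on [set k | k0 <= k]%classic f ->
  ell2_on [set k | k <= k1]%classic f -> ell2 f.
Proof.
move=> /(@ell2_on_right_shift _ k1) fr fl.
by apply: ell2_onS (ell2_onU _ _ _ fr fl) => k _ /=; have [|/ltW] := leP k k1; [right|left].
Qed.

Lemma ell2_finite_support f (n : int) : (forall k, n < `|k| -> f k = 0) -> ell2 f.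
Proof.
move=> f0; apply: (@ell2_right_left (n + 1) (- n - 1)).
  rewrite /ell2_on esum1// => k /= hk; rewrite f0; last by lia.
  by rewrite -/(normc2 0) normc2_0.
rewrite /ell2_on esum1// => k /= hk; rewrite f0; last by lia.
by rewrite -/(normc2 0) normc2_0.
Qed.

End SquareSummable.

(** * The transfer recursion and its flux *)

Lemma oddzN k : oddz (- k) = oddz k.
Proof. by rewrite /oddz abszN. Qed.

Lemma oddzD1 k : oddz (k + 1) = ~~ oddz k.
Proof. rewrite /oddz; lia. Qed.

Lemma oddzB1 k : oddz (k - 1) = ~~ oddz k.
Proof. by rewrite -(subrK 1 k) oddzD1 subrK negbK. Qed.

Section SzegoRecursion.
Context {R : realType}.
Implicit Types (c u v : int -> R[i]) (z : R[i]) (k : int).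

Definition zeta z k : R[i] := if oddz k then z else 1.

(* With [c k = alpha k] for odd [k] and its conjugate for even [k], this is
   [u k, v k = T(z, k) (u (k - 1), v (k - 1))]; the factor [zeta] makes both
   parities have the same form. *)
Definition szego c z u v : Prop := forall k,
  rho c k * u k = c k * u (k - 1) + zeta z k * v (k - 1) /\
  rho c k * (zeta z k * v k) = u (k - 1) + (c k)^* * (zeta z k * v (k - 1)).

(** The division by [1 - normc2 z] gives the flux the same direction of growth for [z] inside and
    outside the unit disk. *)
Definition flux z u v k : R :=
  (if oddz k then normc2 (v k) - normc2 (u k) else normc2 (u k) - normc2 (v k))
  / (1 - normc2 z).

Lemma normc2_rho c k : normc (c k) < 1 -> normc2 (rho c k) = 1 - normc2 (c k).
Proof.
move=> ck; rewrite normc2E /= expr0n addr0 sqr_sqrtr//.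
have h0 : 0 <= normc (c k) by case: (c k) => a b; exact: sqrtr_ge0.
by rewrite subr_ge0 expr_le1// ltW.
Qed.

(** For real [r] the hypotheses say that the block [theta] with entry [a] sends [(x', x)] to
    [(y', y)]; the conclusion is that the block is an isometry. *)
Lemma normc2_block (r a x y x' y' : R[i]) : r != 0 -> normc2 r = 1 - normc2 a ->
  r * x = a * x' + y' -> r * y = x' + a^* * y' ->
  normc2 x + normc2 x' = normc2 y + normc2 y'.
Proof.
move=> r0 ra /(congr1 normc2) ex /(congr1 normc2) ey.
have r20 : normc2 r != 0 by rewrite normc2_eq0.
apply: (mulfI r20); rewrite !mulrDr -!normc2M ex ey !normc2M ra.
move: a x' y' {ex ey ra} => [a1 a2] [x1 x2] [y1 y2].
by rewrite !normc2E /=; ring.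
Qed.

Lemma eq_rho c c' k : normc2 (c k) = normc2 (c' k) -> rho c k = rho c' k.
Proof. by rewrite /normc2 /rho => ->. Qed.

Section Fixed.
Context {c : int -> R[i]} {z : R[i]}.
Hypotheses (hc : forall k, normc (c k) < 1) (z0 : z != 0).

Let zeta0 k : zeta z k != 0.
Proof. by rewrite /zeta; case: ifP => // _; rewrite oner_neq0. Qed.

Let rho0 k : rho c k != 0.
Proof. exact: rho_neq0. Qed.

(** The step is inverted by multiplying with [rho] once more and using [rho ^ 2 = 1 - |c| ^ 2]. *)
Lemma szego_back u v k : szego c z u v ->
  rho c k * u (k - 1) = - (c k)^* * u k + zeta z k * v k /\
  rho c k * (zeta z k * v (k - 1)) = u k - c k * (zeta z k * v k).
Proof.
move=> /(_ k) [hu hv]; have r2 := rho_sqr (hc k).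
split; apply: (mulfI (rho0 k)).
  by rewrite [LHS]mulrA -expr2 r2 mulrDr hv mulrCA hu; ring.
by rewrite [LHS]mulrA -expr2 r2 mulrBr hu [rho c k * (c k * _)]mulrCA hv; ring.
Qed.

Lemma szego_block u v k : szego c z u v ->
  normc2 (u k) + normc2 (u (k - 1)) =
  normc2 (zeta z k) * (normc2 (v k) + normc2 (v (k - 1))).
Proof.
move=> /(_ k) [hu hv]; rewrite mulrDr -!normc2M.
exact: normc2_block (rho0 k) (normc2_rho _ _ (hc k)) hu hv.
Qed.

Lemma szego_eq0 u v k : szego c z u v -> u k = 0 -> v k = 0 ->
  forall j, u j = 0 /\ v j = 0.
Proof.
move=> sz uk vk.
have fwd i : u i = 0 -> v i = 0 -> u (i + 1) = 0 /\ v (i + 1) = 0.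
  move=> ui vi; have [] := sz (i + 1); rewrite addrK ui vi !mulr0 addr0.
  by move=> /eqP; rewrite mulf_eq0 (negPf (rho0 _)) => /eqP ->
    /eqP; rewrite !mulf_eq0 (negPf (rho0 _)) (negPf (zeta0 _)) => /eqP ->.
have bwd i : u i = 0 -> v i = 0 -> u (i - 1) = 0 /\ v (i - 1) = 0.
  move=> ui vi; have [] := szego_back u v i sz; rewrite ui vi !mulr0 subr0 addr0.
  by move=> /eqP; rewrite mulf_eq0 (negPf (rho0 _)) => /eqP ->
    /eqP; rewrite !mulf_eq0 (negPf (rho0 _)) (negPf (zeta0 _)) => /eqP ->.
have hf (n : nat) : u (k + n%:Z) = 0 /\ v (k + n%:Z) = 0.
  elim: n => [|n [un vn]]; first by rewrite addr0.
  by rewrite -addn1 PoszD addrA; exact: fwd.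
have hb (n : nat) : u (k - n%:Z) = 0 /\ v (k - n%:Z) = 0.
  elim: n => [|n [un vn]]; first by rewrite subr0.
  by rewrite -addn1 PoszD opprD addrA; exact: bwd.
move=> j; have [kj|/ltW jk] := leP k j.
  by rewrite (_ : j = k + `|j - k|%N); [exact: hf|lia].
by rewrite (_ : j = k - `|k - j|%N%:Z); [exact: hb|lia].
Qed.

Hypothesis hz : normc2 z != 1.

Let hz' : 1 - normc2 z != 0.
Proof. by rewrite subr_eq0 eq_sym. Qed.

(** At odd [k] the identity [szego_block] carries the factor [|z| ^ 2], which turns the change of
    the numerator into a multiple of [1 - |z| ^ 2]; at even [k] the factor is 1 and the change
    cancels. *)
Lemma flux_step u v k : szego c z u v -> flux z u v k =
  flux z u v (k - 1) + (if oddz k then normc2 (v k) + normc2 (v (k - 1)) else 0).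
Proof.
move=> /(szego_block _ _ k); rewrite /flux oddzB1 /zeta; case: (oddz k) => /=.
  move=> e; apply: (mulIf hz'); rewrite [RHS]mulrDl !divfK//.
  by apply/eqP; rewrite -subr_eq0; apply/eqP; move: e; lra.
by rewrite normc2_1 mul1r addr0 => e; congr (_ / _); move: e; lra.
Qed.

Lemma flux_le u v j k : szego c z u v -> j <= k -> flux z u v j <= flux z u v k.
Proof.
move=> sz jk; rewrite (_ : k = j + `|k - j|%N); last by lia.
elim: `|k - j|%N => [|n]; first by rewrite addr0.
move=> /le_trans; apply; rewrite -addn1 PoszD addrA (flux_step _ _ (_ + 1) sz) addrK lerDl.
by case: ifP => // _; rewrite addr_ge0 ?normc2_ge0.
Qed.

(** Of the two steps from [k - 1] to [k + 1] exactly one ends at an odd index, and its growth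
    contains [normc2 (v k)]; [szego_block] for that step carries the bound over to [u]. *)
Lemma szego_le_flux u v k : szego c z u v ->
  normc2 (v k) <= flux z u v (k + 1) - flux z u v (k - 1) /\
  normc2 (u k) <= normc2 z * (flux z u v (k + 1) - flux z u v (k - 1)).
Proof.
move=> sz; have := flux_step _ _ k sz; have := flux_step _ _ (k + 1) sz.
rewrite addrK oddzD1 => -> ->; case: ifP => odk /=.
  have := szego_block _ _ k sz; rewrite /zeta odk.
  rewrite addr0 -addrA [_ + (_ - _)]addrC subrK => e; split.
    by rewrite lerDl normc2_ge0.
  by rewrite -e lerDl normc2_ge0.
have := szego_block _ _ (k + 1) sz; rewrite /zeta oddzD1 odk addrK /=.
rewrite addr0 [_ - _]addrC addrA addNr add0r => e; split.
  by rewrite lerDr normc2_ge0.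
by rewrite -e lerDr normc2_ge0.
Qed.

(** The two-step increments dominate the terms of both series and telescope, and a nonpositive flux
    bounds their sum. *)
Lemma flux_le0_ell2 u v k0 : szego c z u v -> (forall k, flux z u v k <= 0) ->
  ell2_on [set k | k0 <= k]%classic u /\ ell2_on [set k | k0 <= k]%classic v.
Proof.
move=> sz F0.
have tele (n : nat) : \sum_(i < n)
    (flux z u v (k0 + i%:Z + 1) - flux z u v (k0 + i%:Z - 1)) <=
    - flux z u v k0 - flux z u v (k0 - 1).
  rewrite [leLHS](_ : _ = flux z u v (k0 + n%:Z) + flux z u v (k0 + n%:Z - 1)
     - flux z u v k0 - flux z u v (k0 - 1)).
    have := F0 (k0 + n%:Z); have := F0 (k0 + n%:Z - 1); lra.
  elim: n => [|n IH]; first by rewrite big_ord0 addr0; ring.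
  rewrite big_ord_recr IH /= (_ : k0 + n.+1%:Z = k0 + n%:Z + 1); last by lia.
  by rewrite addrK; ring.
split; apply/ell2_on_rightP.
  exists (normc2 z * (- flux z u v k0 - flux z u v (k0 - 1))) => n.
  apply: le_trans (ler_wpM2l (normc2_ge0 _) (tele n)).
  by rewrite mulr_sumr; apply: ler_sum => i _; have [] := szego_le_flux _ _ (k0 + i%:Z) sz.
exists (- flux z u v k0 - flux z u v (k0 - 1)) => n.
apply: le_trans (tele n).
by apply: ler_sum => i _; have [] := szego_le_flux _ _ (k0 + i%:Z) sz.
Qed.

(** At odd indices [szego_block] bounds [v] by [u], so the flux tends to 0 along them; being
    nondecreasing, it cannot be positive anywhere. *)
Lemma right_ell2_flux_le0 u v k0 k : szego c z u v ->
  ell2_on [set k | k0 <= k]%classic u -> flux z u v k <= 0.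
Proof.
move=> sz hu; rewrite leNgt; apply/negP => Fk.
set t := normc2 z; have t0 : 0 < t by rewrite lt0r normc2_ge0 normc2_eq0 z0.
(* With this [e] the final bound [(2 * e + 2 * e / t) / |1 - t|] is exactly the flux at [k]. *)
pose e := flux z u v k * `|1 - t| / (2 + 2 / t).
have e0 : 0 < e.
  apply: divr_gt0; first by rewrite mulr_gt0 ?normr_gt0.
  by apply: addr_gt0 => //; apply: divr_gt0.
have [K hK] := ell2_on_right_cvg0 _ _ _ e0 hu.
(* An odd index [j >= k] such that [u] is small at both [j] and [j - 1]. *)
pose j := if oddz (Num.max k (K + 1)) then Num.max k (K + 1) else Num.max k (K + 1) + 1.
have oj : oddz j by rewrite /j; case: ifP => // h; rewrite oddzD1 h.
have [jk jK] : k <= j /\ K <= j - 1 by rewrite /j; case: ifP => _; lia.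
have := flux_le _ _ _ _ sz jk; rewrite leNgt => /negP; apply.
have := szego_block _ _ j sz; rewrite /zeta oj -/t => hb.
have uj := hK j ltac:(lia); have uj1 := hK _ jK.
have vj : normc2 (v j) < 2 * e / t.
  rewrite ltr_pdivlMr//; have := normc2_ge0 (v (j - 1)) => vj1.
  have := mulr_ge0 (ltW t0) vj1; move: hb; rewrite mulrDr; lra.
have -> : flux z u v k = (2 * e + 2 * e / t) / `|1 - t|.
  rewrite /e; field; rewrite normr_eq0 hz' !gt_eqF//=; lra.
rewrite /flux oj ltr_pdivlMr ?normr_gt0//.
apply: (@le_lt_trans _ _ (normc2 (v j) + normc2 (u j))).
  (* [s] is the sign of [1 - t]; the bound [|s| <= 1] treats [|z| < 1] and [|z| > 1] together. *)
  rewrite mulrAC -mulrA; set s := `|_| / _.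
  have : `|s| <= 1 by rewrite normrM normr_id normfV divff ?normr_eq0.
  rewrite ler_norml => /andP[s1 s2].
  have := normc2_ge0 (v j); have := normc2_ge0 (u j).
  by move: s1 s2; nra.
by move: uj vj e0; lra.
Qed.

(** If the flux vanishes at [k], monotonicity and nonpositivity make it vanish at [k + 2]; the zero
    increment kills the solution at [k + 1], hence everywhere. *)
Lemma right_ell2_flux_lt0 u v k0 k : szego c z u v ->
  ell2_on [set k | k0 <= k]%classic u -> ~ (forall j, u j = 0 /\ v j = 0) ->
  flux z u v k < 0.
Proof.
move=> sz hu nz; rewrite lt_neqAle (right_ell2_flux_le0 _ _ k0)// andbT.
apply/eqP => F0; apply: nz; have := szego_le_flux _ _ (k + 1) sz; rewrite addrK F0 subr0.
have F2 : flux z u v (k + 1 + 1) = 0.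
  apply/eqP; rewrite eq_le (right_ell2_flux_le0 _ _ k0)//=.
  by rewrite -F0; apply: flux_le; rewrite // -addrA lerDl.
rewrite F2 mulr0 => -[v0 u0]; apply: (szego_eq0 _ _ (k + 1) sz); apply/eqP.
  by rewrite -normc2_eq0 eq_le u0 normc2_ge0.
by rewrite -normc2_eq0 eq_le v0 normc2_ge0.
Qed.

End Fixed.
End SzegoRecursion.

(** * Solutions square summable at one end *)

Section Compactness.
Context {R : realType}.
Local Open Scope classical_set_scope.

(** A pair of complex numbers in four real coordinates, so that compactness reduces to that of real
    segments. *)
Let quad := ((R * R) * (R * R))%type.

Definition fst_c (w : quad) : R[i] := (w.1.1 +i* w.1.2)%C.
Definition snd_c (w : quad) : R[i] := (w.2.1 +i* w.2.2)%C.

Lemma normc2_comb_continuous (p q : R[i]) :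
  continuous (fun w : quad => normc2 (fst_c w * p + snd_c w * q)).
Proof.
move: p q => [p1 p2] [q1 q2].
under eq_fun do rewrite normc2E /= !expr2.
have c11 : continuous (fun w : quad => w.1.1) 
  by move=> w; apply: (cvg_comp _ _ cvg_fst cvg_fst).
have c12 : continuous (fun w : quad => w.1.2).
  by move=> w; apply: (cvg_comp _ _ cvg_fst cvg_snd).
have c21 : continuous (fun w : quad => w.2.1).
  by move=> w; apply: (cvg_comp _ _ cvg_snd cvg_fst).
have c22 : continuous (fun w : quad => w.2.2).
  by move=> w; apply: (cvg_comp _ _ cvg_snd cvg_snd).
have cD (f g : quad -> R) : continuous f -> continuous g -> continuous (fun w => f w + g w).
  by move=> cf cg w; apply: cvgD; [exact: cf|exact: cg].
have cN (f : quad -> R) : continuous f -> continuous (fun w => - f w).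
  by move=> cf w; apply: cvgN; exact: cf.
have cM (f g : quad -> R) : continuous f -> continuous g -> continuous (fun w => f w * g w).
  by move=> cf cg w; apply: cvgM; [exact: cf|exact: cg].
have cc (x : R) : continuous (fun _ : quad => x) by move=> w; exact: cvg_cst.
have cl (f g : quad -> R) a b : continuous f -> continuous g ->
    continuous (fun w => f w * a + g w * b).
  by move=> cf cg; exact: cD _ _ (cM _ _ cf (cc a)) (cM _ _ cg (cc b)).
have clN (f g : quad -> R) a b : continuous f -> continuous g ->
    continuous (fun w => f w * a - g w * b).
  by move=> cf cg; exact: cD _ _ (cM _ _ cf (cc a)) (cN _ (cM _ _ cg (cc b))).
have cRe := cD _ _ (clN _ _ p1 p2 c11 c12) (clN _ _ q1 q2 c21 c22).
have cIm := cD _ _ (cl _ _ p2 p1 c11 c12) (cl _ _ q2 q1 c21 c22).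
exact: cD _ _ (cM _ _ cRe cRe) (cM _ _ cIm cIm).
Qed.

(** The points [w n] have a cluster point on the sphere; each condition [Phi m <= 0] is closed and
    holds for all [w n] with [n >= m], so it passes to that point. *)
Lemma sphere_finite_intersection (Phi : nat -> quad -> R) :
  (forall n, continuous (Phi n)) ->
  (forall n, exists2 w, normc2 (fst_c w) + normc2 (snd_c w) = 1 &
     forall m, (m <= n)%N -> Phi m w <= 0) ->
  exists2 w, normc2 (fst_c w) + normc2 (snd_c w) = 1 & forall m, Phi m w <= 0.
Proof.
move=> cPhi hw.
have /choice[w /all_and2[w1 wPhi]] : forall n, exists w,
    normc2 (fst_c w) + normc2 (snd_c w) = 1 /\ forall m, (m <= n)%N -> Phi m w <= 0.
  by move=> n; have [w] := hw n; exists w.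
pose sphere := [set w : quad | normc2 (fst_c w) + normc2 (snd_c w) = 1].
have closed_sphere : closed sphere.
  have := normc2_comb_continuous 1 0; have := normc2_comb_continuous 0 1.
  under eq_fun do rewrite mulr0 add0r mulr1.
  under [X in _ -> continuous X -> _]eq_fun do rewrite mulr0 addr0 mulr1.
  move=> c2 c1; apply: (@closed_comp _ _ (fun w => normc2 (fst_c w) + normc2 (snd_c w)) [set 1]).
    by move=> v _; apply: cvgD; [exact: c1|exact: c2].
  exact: closed_eq.
have compact_sphere : compact sphere.
  pose I : set R := `[-1, 1].
  apply: (subclosed_compact closed_sphere (B := (I `*` I) `*` (I `*` I))).
    by do !apply: compact_setX; exact: segment_compact.
  have I1 (x y : R) : x ^+ 2 + y = 1 -> 0 <= y -> I x.
    by move=> xy y0; rewrite /I /= in_itv /=; apply/andP; split; nra.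
  move=> [[x1 x2] [y1 y2]]; rewrite /sphere /= !normc2E /= => e.
  have := (sqr_ge0 x1, sqr_ge0 x2, sqr_ge0 y1, sqr_ge0 y2) => -[[[? ?] ?] ?].
  split; split => /=.
  - by apply: (I1 _ (x2 ^+ 2 + y1 ^+ 2 + y2 ^+ 2)); lra.
  - by apply: (I1 _ (x1 ^+ 2 + y1 ^+ 2 + y2 ^+ 2)); lra.
  - by apply: (I1 _ (x2 ^+ 2 + x1 ^+ 2 + y2 ^+ 2)); lra.
  - by apply: (I1 _ (x2 ^+ 2 + y1 ^+ 2 + x1 ^+ 2)); lra.
have wS : (w @ \oo) sphere by exists 0 => // n _; exact: w1.
have [p [sp]] := compact_sphere _ _ wS.
rewrite clusterE => clp; exists p => // m.
have cl : closed [set v | Phi m v <= 0].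
  apply: (@closed_comp _ _ (Phi m) [set x | x <= 0]); last exact: closed_le.
  by move=> v _; exact: cPhi.
by apply: cl; apply: clp; exists m => // n /= mn; exact: wPhi.
Qed.

End Compactness.

Lemma normc_conj (R : realType) (x : R[i]) : normc (x^*) = normc x.
Proof.
by case: x => a b; rewrite -[(_ +i* _)%C^*]/(a -i* b)%C /normc sqrrN.
Qed.

(** * Reflection of the recursion *)

Section Reflection.
Context {R : realType} {c : int -> R[i]} {z : R[i]}.
Hypotheses (hc : forall k, normc (c k) < 1) (z0 : z != 0).
Implicit Types u v : int -> R[i].

(* The recursion is invariant under [k -> -k]: [(u, v)_(-k-1)] solves it for
   these coefficients. *)
Definition reflect_coef (d : int -> R[i]) (k : int) : R[i] := - (d (- k))^*.

Lemma reflect_coefK : reflect_coef (reflect_coef c) = c.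
Proof. by apply/funext => k; rewrite /reflect_coef rmorphN /= conjCK !opprK. Qed.

Lemma normc_reflect_coef k : normc (reflect_coef c k) < 1.
Proof.
by rewrite /reflect_coef normcN normc_conj.
Qed.

(** The backward step at [- k] is a forward step at [k] with the reflected coefficient; [- k] and
    [k] have the same parity, so [zeta] is unchanged. *)
Lemma szego_reflect u v : szego c z u v ->
  szego (reflect_coef c) z (fun k => u (- k - 1)) (fun k => v (- k - 1)).
Proof.
move=> sz k; have [hu hv] := szego_back hc _ _ (- k) sz.
rewrite (eq_rho _ (fun k => c (- k))); last by rewrite normc2N normc2_conj.
rewrite (_ : rho _ k = rho c (- k))// (_ : - (k - 1) - 1 = - k); last by lia.
move: hu hv; rewrite /zeta oddzN /reflect_coef rmorphN /= conjCK => -> ->.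
by split=> //; rewrite mulNr.
Qed.

(** The indices [- k - 1] and [k] have opposite parity, which reverses the sign. *)
Lemma flux_reflect u v k :
  flux z (fun k => u (- k - 1)) (fun k => v (- k - 1)) k = - flux z u v (- k - 1).
Proof. by rewrite /flux oddzB1 oddzN; case: (oddz k) => /=; rewrite -[RHS]mulNr opprB. Qed.

End Reflection.

(** * Solutions with prescribed values and solutions decaying at one end *)

Section Solutions.
Context {R : realType}.
Implicit Types (alpha c u v : int -> R[i]) (z : R[i]).

Definition coef alpha (k : int) : R[i] := if oddz k then alpha k else (alpha k)^*.

Lemma coefK alpha : coef (coef alpha) = alpha.
Proof. by apply/funext => k; rewrite /coef; case: (oddz k); rewrite ?conjCK. Qed.

Lemma normc2_coef alpha k : normc2 (coef alpha k) = normc2 (alpha k).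
Proof. by rewrite /coef; case: ifP; rewrite ?normc2_conj. Qed.

Lemma normc_coef alpha k : normc (coef alpha k) = normc (alpha k).
Proof. by rewrite /coef; case: ifP; rewrite ?normc_conj. Qed.

Lemma rho_coef alpha k : rho (coef alpha) k = rho alpha k.
Proof. by apply: eq_rho; exact: normc2_coef. Qed.

Lemma transfer_szego alpha z (x : int -> 'cV[R[i]]_2) :
  (forall k, normc (alpha k) < 1) -> z != 0 ->
  (forall k, x k = transfer alpha z k *m x (k - 1)) ->
  szego (coef alpha) z (fun k => x k 0 0) (fun k => x k 1 0).
Proof.
move=> halpha z0 hx k; have r0 := rho_neq0 (halpha k).
have row i : x k i 0 = transfer alpha z k i 0 * x (k - 1) 0 0
                       + transfer alpha z k i 1 * x (k - 1) 1 0.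
  rewrite {1}hx mxE !big_ord_recl big_ord0 addr0 (_ : lift ord0 ord0 = 1)//.
  exact: val_inj.
rewrite (row 0) (row 1) rho_coef /transfer /coef /zeta.
by case: ifP => _; rewrite !mxE /= ?conjCK; split; field; rewrite ?r0 ?z0.
Qed.

Lemma szego_sol alpha z k0 (x0 : 'cV[R[i]]_2) :
  (forall k, normc (alpha k) < 1) -> z != 0 ->
  let x := transfer_sol alpha z k0 x0 in
  [/\ szego (coef alpha) z (fun k => x k 0 0) (fun k => x k 1 0),
      x k0 0 0 = x0 0 0 & x k0 1 0 = x0 1 0].
Proof.
move=> halpha z0 x; have [x0E xE] := transfer_solE k0 x0 halpha z0.
by split; [exact: transfer_szego|by rewrite /x x0E..].
Qed.

Lemma szego_comb c z u v u' v' (a b : R[i]) : szego c z u v -> szego c z u' v' ->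
  szego c z (fun k => a * u k + b * u' k) (fun k => a * v k + b * v' k).
Proof.
move=> sz sz' k; have [hu hv] := sz k; have [hu' hv'] := sz' k; split.
  transitivity (a * (rho c k * u k) + b * (rho c k * u' k)); first by ring.
  by rewrite hu hu'; ring.
transitivity (a * (rho c k * (zeta z k * v k)) + b * (rho c k * (zeta z k * v' k))).
  by ring.
by rewrite hv hv'; ring.
Qed.

Section Fixed.
Context {c : int -> R[i]} {z : R[i]}.
Hypotheses (hc : forall k, normc (c k) < 1) (z0 : z != 0).

(** As [coef] is an involution, the system for [c] is the transfer recursion with coefficients
    [coef c]. *)
Lemma szego_exists k0 a b : exists u v, [/\ szego c z u v, u k0 = a & v k0 = b].
Proof.
have hc' k : normc (coef c k) < 1 by rewrite normc_coef.
have [] := szego_sol (coef c) z k0 (cv2 a b) hc' z0.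
rewrite coefK !mxE /= => sz ua vb.
by do 2 eexists; split; [exact: sz| |].
Qed.

Lemma szego_unique u v u' v' k0 : szego c z u v -> szego c z u' v' ->
  u k0 = u' k0 -> v k0 = v' k0 -> forall k, u k = u' k /\ v k = v' k.
Proof.
move=> sz sz' eu ev k; have szd := szego_comb _ _ _ _ _ _ 1 (- 1) sz sz'.
have [||/eqP + /eqP] := szego_eq0 hc z0 _ _ k0 szd _ _ k.
- by rewrite eu mul1r mulN1r subrr.
- by rewrite ev mul1r mulN1r subrr.
by rewrite !mul1r !mulN1r !subr_eq0 => /eqP -> /eqP.
Qed.

Hypothesis hz : normc2 z != 1.

Definition nontrivial u v := ~ forall j, u j = 0 /\ v j = 0.

(** A limit of solutions with zero flux at [n], as [n] grows, has nonpositive flux everywhere, and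
    [flux_le0_ell2] applies. *)
Lemma right_ell2_exists k0 : exists u v, [/\ szego c z u v, nontrivial u v,
  ell2_on [set k | k0 <= k]%classic u & ell2_on [set k | k0 <= k]%classic v].
Proof.
(* These two solutions form the standard basis at index 0, so the coordinates of [w] are the values
   of [sol w] and [sol' w] there. *)
have [p [p' [szp p1 p'0]]] := szego_exists 0 1 0.
have [q [q' [szq q0 q'1]]] := szego_exists 0 0 1.
pose sol w k := fst_c w * p k + snd_c w * q k.
pose sol' w k := fst_c w * p' k + snd_c w * q' k.
have szw w : szego c z (sol w) (sol' w) by exact: szego_comb.
have [||w w1 wF] := sphere_finite_intersection (fun n w => flux z (sol w) (sol' w) n%:Z).
- move=> n w; apply: cvgM; last exact: cvg_cst.
  have cu := normc2_comb_continuous (p n) (q n).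
  have cv := normc2_comb_continuous (p' n) (q' n).
  by case: (oddz n); (apply: cvgB; [exact: cu || exact: cv|exact: cu || exact: cv]).
(* Equal moduli at [n] make the flux vanish there, hence nonpositive at every earlier index. *)
- move=> n; have [u [v [sz un vn]]] := szego_exists n%:Z 1 1.
  (* The solution is scaled to unit length at index 0; it is nonzero there because it is nonzero at
     [n]. *)
  pose s := Num.sqrt (normc2 (u 0) + normc2 (v 0)).
  have s2 : s ^+ 2 = normc2 (u 0) + normc2 (v 0) by rewrite sqr_sqrtr// addr_ge0 ?normc2_ge0.
  have s0 : s != 0.
    rewrite -sqrf_eq0 s2 paddr_eq0 ?normc2_ge0// !normc2_eq0; apply/negP => /andP[/eqP u0 /eqP v0].
    have [] := szego_eq0 hc z0 _ _ _ sz u0 v0 n%:Z.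
    by rewrite un => /eqP; rewrite oner_eq0.
  pose x := (s^-1)%:C%C * u 0; pose y := (s^-1)%:C%C * v 0.
  have xE : (complex.Re x +i* complex.Im x)%C = x by case: (x).
  have yE : (complex.Re y +i* complex.Im y)%C = y by case: (y).
  pose w := ((complex.Re x, complex.Im x), (complex.Re y, complex.Im y)).
  exists w.
    rewrite /fst_c /snd_c /= xE yE !normc2M -mulrDr -s2 normc2E /= expr0n addr0.
    by rewrite -exprMn mulVf// expr1n.
  move=> m mn; rewrite (_ : flux _ _ _ _ = normc2 (s^-1)%:C%C * flux z u v m%:Z).
    rewrite mulr_ge0_le0 ?normc2_ge0//.
    rewrite (@le_trans _ _ (flux z u v n%:Z))//; first exact: flux_le.
    by rewrite /flux un vn subrr if_same mul0r.
  have comb := szego_comb _ _ _ _ _ _ (s^-1)%:C%C 0 sz sz.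
  have [||eu ev] := szego_unique _ _ _ _ 0 (szw w) comb _ _ m%:Z.
  - by rewrite /sol /fst_c /snd_c /= xE yE p1 q0 mulr1 mulr0 mul0r !addr0.
  - by rewrite /sol' /fst_c /snd_c /= xE yE p'0 q'1 mulr1 mulr0 mul0r addr0 add0r.
  rewrite /flux eu ev !mul0r !addr0 !normc2M.
  by case: ifP => _; ring.
(* Nonpositivity at the natural indices extends to negative ones by monotonicity. *)
have F0 k : flux z (sol w) (sol' w) k <= 0.
  apply: (le_trans _ (wF `|k|%N)); apply: (flux_le hc z0 hz) => //; lia.
exists (sol w), (sol' w); have [] := flux_le0_ell2 hc z0 hz _ _ k0 (szw w) F0.
split=> // /(_ 0); rewrite /sol /sol' p1 p'0 q0 q'1 !mulr1 !mulr0 addr0 add0r => -[x0 y0].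
by move/eqP: w1; rewrite x0 y0 normc2_0 addr0 eq_sym oner_eq0.
Qed.

End Fixed.

Section Left.
Context {c : int -> R[i]} {z : R[i]}.
Hypotheses (hc : forall k, normc (c k) < 1) (z0 : z != 0) (hz : normc2 z != 1).

Let hrc : forall k, normc (reflect_coef c k) < 1.
Proof. exact: normc_reflect_coef. Qed.

Lemma left_ell2_exists k0 : exists u v, [/\ szego c z u v, nontrivial u v,
  ell2_on [set k | k <= k0]%classic u & ell2_on [set k | k <= k0]%classic v].
Proof.
have [u [v [sz nt hu hv]]] := right_ell2_exists hrc z0 hz (- k0 - 1).
exists (fun k => u (- k - 1)), (fun k => v (- k - 1)).
have twice (k : int) : - (- k - 1) - 1 = k by lia.
split.
- by have := szego_reflect hrc z0 _ _ sz; rewrite reflect_coefK.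
- by move=> h; apply: nt => j; have := h (- j - 1); rewrite twice.
- by apply/ell2_on_reflect; apply: eq_ell2_on hu => k _; rewrite twice.
- by apply/ell2_on_reflect; apply: eq_ell2_on hv => k _; rewrite twice.
Qed.

(** The reflected solution is square summable on the right, and reflection changes the sign of the
    flux. *)
Lemma left_ell2_flux_gt0 u v k0 k : szego c z u v ->
  ell2_on [set k | k <= k0]%classic u -> nontrivial u v -> 0 < flux z u v k.
Proof.
move=> sz /ell2_on_reflect hu nt.
have szr := szego_reflect hc z0 _ _ sz.
have := right_ell2_flux_lt0 hrc z0 hz _ _ _ (- k - 1) szr hu.
rewrite flux_reflect (_ : - (- k - 1) - 1 = k) ?oppr_lt0; last by lia.
apply=> h; apply: nt => j; have := h (- j - 1).
by rewrite (_ : - (- j - 1) - 1 = j); last by lia.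
Qed.

(** Otherwise the flux would be both negative and positive. *)
Lemma szego_ell2_trivial u v k0 k1 : szego c z u v ->
  ell2_on [set k | k0 <= k]%classic u -> ell2_on [set k | k <= k1]%classic u ->
  forall j, u j = 0 /\ v j = 0.
Proof.
move=> sz ur ul; apply: contrapT => nt.
have := right_ell2_flux_lt0 hc z0 hz _ _ _ 0 sz ur nt.
by rewrite ltNge ltW// (left_ell2_flux_gt0 _ _ _ _ sz ul nt).
Qed.

End Left.
End Solutions.

(** * Weyl solutions *)

Section Weyl.
Context {R : realType} {alpha : int -> R[i]} {z : R[i]}.
Hypotheses (halpha : forall k, normc (alpha k) < 1) (z0 : z != 0) (hz : normc2 z != 1).
Implicit Types k : int.

Let hc k : normc (coef alpha k) < 1.
Proof. by rewrite normc_coef. Qed.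

Lemma pr_plus_szego k0 : szego (coef alpha) z
  (fun k => p_plus alpha z k k0) (fun k => r_plus alpha z k k0).
Proof. by have [] := szego_sol alpha z k0 (if oddz k0 then cv2 z 1 else cv2 1 1) halpha z0. Qed.

Lemma qs_plus_szego k0 : szego (coef alpha) z
  (fun k => q_plus alpha z k k0) (fun k => s_plus alpha z k k0).
Proof.
by have [] := szego_sol alpha z k0 (if oddz k0 then cv2 z (- 1) else cv2 (- 1) 1) halpha z0.
Qed.

Lemma pr_plus0 k0 : p_plus alpha z k0 k0 = (if oddz k0 then z else 1) /\
  r_plus alpha z k0 k0 = 1.
Proof.
have [_ p0 r0] := szego_sol alpha z k0 (if oddz k0 then cv2 z 1 else cv2 1 1) halpha z0.
by split; [apply: etrans p0 _|apply: etrans r0 _]; case: ifP => _; rewrite mxE.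
Qed.

Lemma qs_plus0 k0 : q_plus alpha z k0 k0 = (if oddz k0 then z else - 1) /\
  s_plus alpha z k0 k0 = (if oddz k0 then - 1 else 1).
Proof.
have [_ p0 r0] :=
  szego_sol alpha z k0 (if oddz k0 then cv2 z (- 1) else cv2 (- 1) 1) halpha z0.
by split; [apply: etrans p0 _|apply: etrans r0 _]; case: ifP => _; rewrite mxE.
Qed.

Definition weyl_u m k0 k := q_plus alpha z k k0 + m * p_plus alpha z k k0.
Definition weyl_v m k0 k := s_plus alpha z k k0 + m * r_plus alpha z k k0.

Lemma weyl_szego m k0 : szego (coef alpha) z (weyl_u m k0) (weyl_v m k0).
Proof.
move=> k; have := szego_comb _ _ _ _ _ _ 1 m (qs_plus_szego k0) (pr_plus_szego k0) k.
by rewrite !mul1r.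
Qed.

Lemma weyl_init m k0 :
  weyl_u m k0 k0 = (if oddz k0 then z * (1 + m) else m - 1) /\
  weyl_v m k0 k0 = (if oddz k0 then m - 1 else m + 1).
Proof.
have [p0 r0] := pr_plus0 k0; have [q0 s0] := qs_plus0 k0.
by rewrite /weyl_u /weyl_v p0 r0 q0 s0; case: ifP => _; split; ring.
Qed.

(** At [k0] the components are [m + 1] and [m - 1], in some order and up to a nonzero factor; they
    differ by 2. *)
Lemma weyl_nontrivial m k0 : nontrivial (weyl_u m k0) (weyl_v m k0).
Proof.
have two0 : m + 1 = 0 -> m - 1 = 0 -> False.
  move=> h1 h2; have : m + 1 - (m - 1) == 0 by rewrite h1 h2 subrr.
  by rewrite (_ : _ - _ = 2%:R) ?pnatr_eq0//; ring.
move=> /(_ k0); have [-> ->] := weyl_init m k0; case: ifP => _ [].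
  by move=> /eqP; rewrite mulf_eq0 (negPf z0) addrC => /eqP; exact: two0.
by move=> h1 h2; exact: two0 h2 h1.
Qed.

Lemma pr_plus_nontrivial k0 :
  nontrivial (fun k => p_plus alpha z k k0) (fun k => r_plus alpha z k k0).
Proof.
by move=> /(_ k0) [_ /eqP]; have [_ ->] := pr_plus0 k0; rewrite oner_eq0.
Qed.

Let hz' : 1 - normc2 z != 0.
Proof. by rewrite subr_eq0 eq_sym. Qed.

(** The value is 1 for odd [k0] and 0 for even [k0]. This excludes that [p_plus] is square summable
    on the right. *)
Lemma pr_plus_flux_ge0 k0 :
  0 <= flux z (fun k => p_plus alpha z k k0) (fun k => r_plus alpha z k k0) k0.
Proof.
have [p0 r0] := pr_plus0 k0; rewrite /flux p0 r0 normc2_1.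
by case: (oddz k0); [rewrite divff ?ler01|rewrite normc2_1 subrr mul0r].
Qed.

(** For odd [k0] the step to [k0] adds at least [normc2 1] to the flux, which is 1 at [k0]; for even
    [k0] both values are 0. This excludes that [p_plus] is square summable on the left. *)
Lemma pr_plus_flux_le0 k0 :
  flux z (fun k => p_plus alpha z k k0) (fun k => r_plus alpha z k k0) (k0 - 1) <= 0.
Proof.
have := flux_step hc hz _ _ k0 (pr_plus_szego k0).
have [p0 r0] := pr_plus0 k0; rewrite {1}/flux p0 r0 normc2_1.
case: (oddz k0); last by rewrite normc2_1 subrr mul0r addr0 => <-.
by rewrite divff//; have := normc2_ge0 (r_plus alpha z (k0 - 1) k0); lra.
Qed.

(** The given solution is [A q + B p]. If [A] were 0, [p] itself would be square summable; so
    division by [A] is possible and [m = B / A]. *)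
Lemma weyl_on_exists k0 (D : set int) :
  ~ ell2_on D (fun k => p_plus alpha z k k0) ->
  (exists u v, [/\ szego (coef alpha) z u v, nontrivial u v, ell2_on D u & ell2_on D v]) ->
  exists m, weyl_on alpha D z k0 m.
Proof.
move=> Dp [u [v [sz nt Du Dv]]].
have [p0 r0] := pr_plus0 k0; have [q0 s0] := qs_plus0 k0.
(* [s / 2] and [t / 2] solve the linear system for [A] and [B] given by the initial values at
   [k0]. *)
pose s := if oddz k0 then u k0 / z - v k0 else v k0 - u k0.
pose t := if oddz k0 then u k0 / z + v k0 else v k0 + u k0.
pose A := s / 2; pose B := t / 2.
have comb := szego_comb _ _ _ _ _ _ A B (qs_plus_szego k0) (pr_plus_szego k0).
have e := szego_unique hc z0 _ _ _ _ k0 sz comb.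
have {}e k : u k = A * q_plus alpha z k k0 + B * p_plus alpha z k k0 /\
             v k = A * s_plus alpha z k k0 + B * r_plus alpha z k k0.
  apply: e.
    by rewrite p0 q0 /A /B /s /t; case: ifP => _; field; rewrite ?z0.
  by rewrite r0 s0 /A /B /s /t; case: ifP => _; field; rewrite ?z0.
have A0 : A != 0.
  apply/eqP => A0; have [B0|B0] := eqVneq B 0.
    by apply: nt => k; have [-> ->] := e k; rewrite A0 B0 !mul0r addr0.
  apply: Dp; apply: eq_ell2_on (ell2_onZ _ B^-1 _ Du) => k _ /=.
  by have [-> _] := e k; rewrite A0 mul0r add0r mulKf.
exists (B / A); split.
  apply: eq_ell2_on (ell2_onZ _ A^-1 _ Du) => k _ /=.
  by have [-> _] := e k; field; rewrite A0.
apply: eq_ell2_on (ell2_onZ _ A^-1 _ Dv) => k _ /=.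
by have [_ ->] := e k; field; rewrite A0.
Qed.

(** Existence makes [xget] return a member of the set rather than the default [0]. *)
Lemma M_plus_weyl k0 : weyl_on alpha [set k | k0 <= k]%classic z k0 (M_plus alpha z k0).
Proof.
rewrite /M_plus (negPf z0).
apply: (@xgetPex _ 0 [set m | weyl_on alpha _ z k0 m]%classic); apply: weyl_on_exists.
  move=> /(right_ell2_flux_lt0 hc z0 hz _ _ _ k0 (pr_plus_szego k0)) /(_ (pr_plus_nontrivial k0)).
  by rewrite ltNge pr_plus_flux_ge0.
exact: right_ell2_exists hc z0 hz k0.
Qed.

Lemma M_minus_weyl k0 : weyl_on alpha [set k | k <= k0]%classic z k0 (M_minus alpha z k0).
Proof.
rewrite /M_minus (negPf z0).
apply: (@xgetPex _ 0 [set m | weyl_on alpha _ z k0 m]%classic); apply: weyl_on_exists.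
  move=> /(left_ell2_flux_gt0 hc z0 hz _ _ _ (k0 - 1) (pr_plus_szego k0)).
  move=> /(_ (pr_plus_nontrivial k0)).
  by rewrite ltNge pr_plus_flux_le0.
exact: left_ell2_exists hc z0 hz k0.
Qed.

(** A common value would give a nontrivial solution that is square summable at both ends. *)
Lemma M_plus_neq_minus k0 : M_plus alpha z k0 != M_minus alpha z k0.
Proof.
apply/eqP => e; have [wp _] := M_plus_weyl k0; have [wm _] := M_minus_weyl k0.
rewrite -e in wm; apply: (weyl_nontrivial (M_plus alpha z k0) k0).
exact: szego_ell2_trivial hc z0 hz _ _ _ _ (weyl_szego _ _) wp wm.
Qed.

End Weyl.

(** * The resolvent *)

Section Resolvent.
Context {R : realType} {alpha : int -> R[i]} {z : R[i]}.
Hypotheses (halpha : forall k, normc (alpha k) < 1) (z0 : z != 0).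
Implicit Types (f g u v : int -> R[i]) (j k : int).

Let hc k : normc (coef alpha k) < 1.
Proof. by rewrite normc_coef. Qed.

Let rho0 k : rho alpha k != 0.
Proof. exact: rho_neq0. Qed.

Lemma block_opE b f j : block_op alpha b f j =
  if oddz j == b then rho alpha j * f (j - 1) + (alpha j)^* * f j
  else - alpha (j + 1) * f j + rho alpha (j + 1) * f (j + 1).
Proof. by rewrite /block_op; case: ifP => _; rewrite !mxE !big_ord_recl big_ord0 !mxE /= addr0. Qed.

Lemma block_opZ b (a : R[i]) f j :
  block_op alpha b (fun k => a * f k) j = a * block_op alpha b f j.
Proof. by rewrite !block_opE; case: ifP => _; ring. Qed.

Lemma block_opB b f g j :
  block_op alpha b (fun k => f k - g k) j = block_op alpha b f j - block_op alpha b g j.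
Proof. by rewrite !block_opE; case: ifP => _; ring. Qed.

Lemma opUB f g j : opU alpha (fun k => f k - g k) j = opU alpha f j - opU alpha g j.
Proof.
rewrite /opU /opV /opW -block_opB; congr (block_op _ _ _ _).
by apply/funext => k; rewrite block_opB.
Qed.

Lemma szego_odd u v k : szego (coef alpha) z u v -> oddz k ->
  [/\ rho alpha k * u k = alpha k * u (k - 1) + z * v (k - 1),
      rho alpha k * (z * v k) = u (k - 1) + (alpha k)^* * (z * v (k - 1)),
      rho alpha k * u (k - 1) = - (alpha k)^* * u k + z * v k &
      rho alpha k * (z * v (k - 1)) = u k - alpha k * (z * v k)].
Proof.
move=> sz ok; have := szego_back hc _ _ k sz; have := sz k.
by rewrite rho_coef /coef /zeta ok => -[? ?] [? ?].
Qed.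

Lemma szego_even u v k : szego (coef alpha) z u v -> ~~ oddz k ->
  [/\ rho alpha k * u k = (alpha k)^* * u (k - 1) + v (k - 1),
      rho alpha k * v k = u (k - 1) + alpha k * v (k - 1),
      rho alpha k * u (k - 1) = - alpha k * u k + v k &
      rho alpha k * v (k - 1) = u k - (alpha k)^* * v k].
Proof.
move=> sz /negPf ok; have := szego_back hc _ _ k sz; have := sz k.
by rewrite rho_coef /coef /zeta ok !mul1r conjCK => -[? ?] [? ?].
Qed.

(** Together with [szego_opV_even] this reads the recursion block by block as [W u = z v] and
    [V v = u]. *)
Lemma szego_opW_odd u v k : szego (coef alpha) z u v -> oddz k ->
  - alpha k * u (k - 1) + rho alpha k * u k = z * v (k - 1) /\
  rho alpha k * u (k - 1) + (alpha k)^* * u k = z * v k.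
Proof.
move=> sz ok; have [-> _ -> _] := szego_odd _ _ _ sz ok.
by split; ring.
Qed.

Lemma szego_opV_even u v k : szego (coef alpha) z u v -> ~~ oddz k ->
  - alpha k * v (k - 1) + rho alpha k * v k = u (k - 1) /\
  rho alpha k * v (k - 1) + (alpha k)^* * v k = u k.
Proof.
move=> sz ok; have [_ -> _ ->] := szego_even _ _ _ sz ok.
by split; ring.
Qed.

(* The first-order system is recovered from [U u = z u] by [v = W u / z]. *)
Lemma eigen_szego u : (forall k, opU alpha u k = z * u k) ->
  szego (coef alpha) z u (fun k => opW alpha u k / z).
Proof.
move=> hu k; rewrite rho_coef /coef /zeta; case: (boolP (oddz k)) => ok.
  have -> : opW alpha u k = rho alpha k * u (k - 1) + (alpha k)^* * u k.
    by rewrite /opW block_opE ok.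
  have -> : opW alpha u (k - 1) = - alpha k * u (k - 1) + rho alpha k * u k.
    by rewrite /opW block_opE oddzB1 ok /= subrK.
  have := rho_sqr (halpha k); rewrite expr2 => r2.
  split; first by field; rewrite ?z0.
  transitivity (rho alpha k * rho alpha k * u (k - 1) + rho alpha k * (alpha k)^* * u k).
    by field; rewrite ?z0.
  by rewrite r2; field; rewrite ?z0.
have e1 := hu k; have e2 := hu (k - 1).
have {}e1 : rho alpha k * opW alpha u (k - 1) + (alpha k)^* * opW alpha u k = z * u k.
  by rewrite -e1 /opU /opV block_opE (negPf ok).
have {}e2 : - alpha k * opW alpha u (k - 1) + rho alpha k * opW alpha u k = z * u (k - 1).
  by rewrite -e2 /opU /opV block_opE oddzB1 ok /= subrK.
move: (opW alpha u k) (opW alpha u (k - 1)) e1 e2 => x y e1 e2.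
have uk : u k = (rho alpha k * y + (alpha k)^* * x) / z by rewrite e1 mulrC mulKf.
have uk1 : u (k - 1) = (- alpha k * y + rho alpha k * x) / z by rewrite e2 mulrC mulKf.
have r2 : rho alpha k * rho alpha k = 1 - alpha k * (alpha k)^*.
  by rewrite -(rho_sqr (halpha k)) expr2.
rewrite uk uk1 !mul1r conjCK; split; last by field; rewrite ?z0.
transitivity ((rho alpha k * rho alpha k * y + rho alpha k * (alpha k)^* * x) / z).
  by field; rewrite ?z0.
by rewrite r2; field; rewrite ?z0.
Qed.

Hypothesis hz : normc2 z != 1.

(** Two preimages of [delta] differ by a square summable solution of [U u = z u], which is zero. *)
Lemma ell2_inv_opU g j : ell2 g ->
  (forall k, opU alpha g k = z * g k + delta R j k) ->
  ell2_inv (opU_shift alpha (- z)) (delta R j) = g.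
Proof.
move=> g2 hg; apply: xget_unique.
  by split=> //; apply/funext => k; rewrite /opU_shift hg mulNr addrAC subrr add0r.
move=> h [h2 hh]; apply/funext => k; apply/eqP; rewrite -subr_eq0; apply/eqP.
have sz : szego (coef alpha) z (fun k => h k - g k)
    (fun k => opW alpha (fun k => h k - g k) k / z).
  apply: eigen_szego => i; rewrite opUB hg.
  have := congr1 (@^~ i) hh; rewrite /opU_shift mulNr => <-; ring.
have d2 D : ell2_on D (fun k => h k - g k).
  apply: (@eq_ell2_on _ _ (fun k => h k + (-1) * g k)) => [i _|]; first by rewrite mulN1r.
  by apply: ell2_onD; [|apply: ell2_onZ]; apply: ell2_onS (_ : ell2 _) => // i _.
by have [] := szego_ell2_trivial hc z0 hz _ _ 0 0 sz (d2 _) (d2 _) k.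
Qed.

(** With [(U - z) g = delta] one has [(U + z) g = delta + 2 z g]. *)
Lemma Mll_green (l l' : 'I_2) k g : ell2 g ->
  (forall i, opU alpha g i = z * g i + delta R (k - 1 + (l' : nat)%:Z) i) ->
  Mll alpha l l' z k = (l == l')%:R + 2 * z * g (k - 1 + (l : nat)%:Z).
Proof.
move=> g2 hg; rewrite /Mll (ell2_inv_opU _ _ g2 hg) ell2_dot_delta /opU_shift hg.
rewrite /delta (_ : (_ == _) = (l == l')); first by ring.
by rewrite (inj_eq (addrI _)).
Qed.

(** * The kernel of the resolvent *)

Section Green.
Context {up vp um vm : int -> R[i]} {kp km : int}.
Hypotheses (szp : szego (coef alpha) z up vp) (szm : szego (coef alpha) z um vm)
  (up2 : ell2_on [set k | kp <= k]%classic up)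
  (um2 : ell2_on [set k | k <= km]%classic um).

Definition glue (i0 : int) (a b : R[i]) f g (i : int) : R[i] :=
  if i0 <= i then a * f i else b * g i.

Lemma glue_ell2 i0 a b : ell2 (glue i0 a b up um).
Proof.
apply: (@ell2_right_left _ i0 (i0 - 1)).
  apply: eq_ell2_on (ell2_onZ _ a _ (ell2_on_right_shift _ i0 _ up2)) => i /= hi.
  by rewrite /glue hi.
apply: eq_ell2_on (ell2_onZ _ b _ (ell2_on_left_shift _ (i0 - 1) _ um2)) => i /= hi.
by rewrite /glue ifN//; lia.
Qed.

(* Both factors of [U = V W] act blockwise. The cut at an even [i0] respects
   the blocks of [W] and splits exactly one block of [V], the one on [i0 - 1]
   and [i0]; the hypotheses are the two rows of that block. *)
Lemma glue_resolvent i0 a b j : ~~ oddz i0 ->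
  rho alpha i0 * (a * vp i0 - b * vm i0) = (j == i0 - 1)%:R / z ->
  rho alpha i0 * (b * vm (i0 - 1) - a * vp (i0 - 1)) = (j == i0)%:R / z ->
  (j == i0) || (j == i0 - 1) ->
  forall i, opU alpha (glue i0 a b up um) i = z * glue i0 a b up um i + delta R j i.
Proof.
move=> ei0 h1 h2 hj i.
have hW : opW alpha (glue i0 a b up um) = (fun i => z * glue i0 a b vp vm i).
  apply/funext => k; rewrite /opW block_opE; case: (boolP (oddz k)) => ok /=.
    have [_ ep] := szego_opW_odd _ _ _ szp ok.
    have [_ em] := szego_opW_odd _ _ _ szm ok.
    (* [k] is odd and [i0] even, so [k - 1] and [k] lie on the same side of the cut. *)
    have -> : glue i0 a b up um (k - 1) =
        if i0 <= k then a * up (k - 1) else b * um (k - 1).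
      rewrite /glue; have [le_ik|lt_ki] := leP i0 k; last by rewrite ifN//; lia.
      have [ik|ik] := eqVneq i0 k; first by move: ei0; rewrite ik ok.
      by rewrite ifT//; lia.
    by rewrite /glue; case: ifP => _; [rewrite [RHS]mulrCA -ep|rewrite [RHS]mulrCA -em]; ring.
  have ok1 : oddz (k + 1) by rewrite oddzD1.
  have [ep _] := szego_opW_odd _ _ _ szp ok1.
  have [em _] := szego_opW_odd _ _ _ szm ok1.
  rewrite addrK in ep em.
  have -> : glue i0 a b up um (k + 1) =
      if i0 <= k then a * up (k + 1) else b * um (k + 1).
    rewrite /glue; have [le_ik|lt_ki] := leP i0 k; first by rewrite ifT//; lia.
    have [ik|ik] := eqVneq i0 (k + 1); first by move: ei0; rewrite ik ok1.
    by rewrite ifN//; lia.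
  by rewrite /glue; case: ifP => _; [rewrite [RHS]mulrCA -ep|rewrite [RHS]mulrCA -em]; ring.
rewrite /opU hW /opV block_opZ.
(* [W] has turned the glued [u] into [z] times the glued [v]; what is left is the action of [V] on
   the latter. *)
suff -> : block_op alpha false (glue i0 a b vp vm) i = glue i0 a b up um i + delta R j i / z.
  by rewrite mulrDr [z * (_ / _)]mulrC divfK.
rewrite block_opE /delta eqbF_neg; case: (boolP (oddz i)) => oi /=.
  have ei1 : ~~ oddz (i + 1) by rewrite oddzD1 oi.
  have [ep _] := szego_opV_even _ _ _ szp ei1.
  have [em _] := szego_opV_even _ _ _ szm ei1.
  rewrite addrK in ep em.
  have [ii0|ni] := eqVneq (i + 1) i0.
    have -> : i = i0 - 1 by lia.
    rewrite /glue subrK lexx !ifN; try by lia.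
    have [<- _] := szego_opV_even _ _ _ szm ei0.
    by rewrite eq_sym -h1; ring.
  have -> : (i == j) = false by apply/negP => /eqP ij; move: hj ni oi ei0;
    rewrite -ij => /orP[/eqP <- _ ->//|/eqP ->]; rewrite subrK eqxx.
  have -> : glue i0 a b vp vm (i + 1) =
      if i0 <= i then a * vp (i + 1) else b * vm (i + 1).
    rewrite /glue; have [le_ik|lt_ki] := leP i0 i; first by rewrite ifT//; lia.
    by rewrite ifN//; lia.
  by rewrite mul0r addr0 /glue; case: ifP => _; [rewrite -ep|rewrite -em]; ring.
have [_ ep] := szego_opV_even _ _ _ szp oi.
have [_ em] := szego_opV_even _ _ _ szm oi.
have [ii0|ni] := eqVneq i i0.
  rewrite ii0 in ep em *.
  rewrite /glue lexx ifN; last by lia.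
  rewrite eq_sym -h2 -ep; ring.
have -> : (i == j) = false.
  apply/negP => /eqP ij; move: hj ni oi ei0; rewrite -ij => /orP[/eqP ->|/eqP ->].
    by rewrite eqxx.
  by rewrite oddzB1 negbK => _ ->.
have -> : glue i0 a b vp vm (i - 1) =
    if i0 <= i then a * vp (i - 1) else b * vm (i - 1).
  rewrite /glue; have [le_ik|lt_ki] := leP i0 i; last by rewrite ifN//; lia.
  by rewrite ifT//; lia.
by rewrite mul0r addr0 /glue; case: ifP => _; [rewrite -ep|rewrite -em]; ring.
Qed.

(** [w] is the Wronskian of the [v] components across the cut, scaled by [z] and [rho]. The source
    [j] must lie next to the even cut [i0], while [i] is free. *)
Lemma Mll_wronskian (l l' : 'I_2) k i j i0 (w : R[i]) :
  k - 1 + (l : nat)%:Z = i -> k - 1 + (l' : nat)%:Z = j ->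
  ~~ oddz i0 -> (j == i0) || (j == i0 - 1) -> w != 0 ->
  z * (rho alpha i0 * (vp i0 * vm (i0 - 1) - vm i0 * vp (i0 - 1))) = w ->
  Mll alpha l l' z k = (l == l')%:R +
    2 * z * (if i0 <= i then vm j * up i else vp j * um i) / w.
Proof.
move=> <- ij ei0 hj w0 hw.
have X : rho alpha i0 * (vp i0 * vm (i0 - 1) - vm i0 * vp (i0 - 1)) = w / z.
  by rewrite -hw [z * _]mulrC mulfK.
(* The weights [vm j / w] and [vp j / w] solve the two row equations of the split block by Cramer's
   rule. *)
have res : forall i, opU alpha (glue i0 (vm j / w) (vp j / w) up um) i =
    z * glue i0 (vm j / w) (vp j / w) up um i + delta R j i.
  apply: glue_resolvent => //; case/orP: hj => /eqP ->; rewrite ?eqxx.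
  - rewrite (_ : (_ == _) = false) ?mul0r; last by apply/eqP; lia.
    by ring.
  - by rewrite mul1r -[z^-1](mulKf w0) -X; ring.
  - by rewrite mul1r -[z^-1](mulKf w0) -X; ring.
  rewrite (_ : (_ == _) = false) ?mul0r; last by apply/eqP; lia.
  by ring.
rewrite -ij in res *; rewrite (Mll_green _ _ _ _ (glue_ell2 _ _ _) res) /glue.
by case: ifP => _; ring.
Qed.

End Green.
End Resolvent.

(** * The case [z = 0] *)

Section AtZero.
Context {R : realType} {alpha : int -> R[i]}.
Hypothesis halpha : forall k, normc (alpha k) < 1.

(** Conjugating [alpha] turns each block [theta] into its adjoint, which is its inverse. *)
Lemma block_op_conjK b (f : int -> R[i]) :
  block_op alpha b (block_op (fun k => (alpha k)^*) b f) = f.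
Proof.
have rhoC k : rho (fun k => (alpha k)^*) k = rho alpha k.
  by apply: eq_rho; rewrite normc2_conj.
have r2 k : rho alpha k * rho alpha k = 1 - alpha k * (alpha k)^*.
  by rewrite -(rho_sqr (halpha k)) expr2.
apply/funext => j; rewrite !block_opE; case: (boolP (oddz j == b)) => oj.
  rewrite ifN; last by rewrite oddzB1; case: (oddz j) b oj => [] [].
  by rewrite subrK !rhoC conjCK mulrDr mulrA mulrA r2; ring.
rewrite oddzD1 ifT; last by case: (oddz j) b oj => [] [].
by rewrite addrK !rhoC conjCK [X in _ + X]mulrDr mulrA r2; ring.
Qed.

(** The preimage is the adjoint of [W] applied to the adjoint of [V] on [delta]. Each factor
    enlarges the support by at most one index on either side, hence the radius [|j| + 2]. *)
Lemma opU_preimage_delta j : exists2 g, ell2 g & opU alpha g = delta R j.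
Proof.
pose ac k := (alpha k)^*.
exists (block_op ac true (block_op ac false (delta R j))); last first.
  by rewrite /opU /opW /opV !block_op_conjK.
apply: (@ell2_finite_support _ _ (`|j| + 2)) => k hk.
have d0 i : `|j| < `|i| -> delta R j i = 0.
  by move=> ji; rewrite /delta (_ : (i == j) = false)//; apply/eqP; lia.
have d i : `|j| + 1 < `|i| -> block_op ac false (delta R j) i = 0.
  move=> ji; rewrite block_opE (d0 i) ?(d0 (i - 1)) ?(d0 (i + 1)); try by lia.
  by case: ifP; rewrite !mulr0 addr0.
rewrite block_opE (d k) ?(d (k - 1)) ?(d (k + 1)); try by lia.
by case: ifP; rewrite !mulr0 addr0.
Qed.

(** At [z = 0] the operators [U + z] and [U - z] coincide and cancel on [delta]. *)
Lemma Mll_at0 (l l' : 'I_2) k : Mll alpha l l' 0 k = (l == l')%:R.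
Proof.
rewrite /Mll oppr0 ell2_dot_delta.
set A := opU_shift alpha 0; set d := delta R _.
have [g g2 hg] := opU_preimage_delta (k - 1 + (l' : nat)%:Z).
have [_ ->] : ell2 (ell2_inv A d) /\ A (ell2_inv A d) = d.
  apply: (@xgetPex _ (fun=> 0) [set g | ell2 g /\ A g = d]%classic); exists g; split=> //.
  by rewrite /d -hg; apply/funext => i; rewrite /A /opU_shift mul0r addr0.
by rewrite /d /delta (inj_eq (addrI _)).
Qed.

End AtZero.

(** * The four formulas *)

Theorem lemma3p2 (R : realType) (alpha : int -> R[i])
    (halpha : forall k : int, normc (alpha k) < 1)
    (z : R[i]) (hz : normc z != 1) (k : int) :
  let Mp := M_plus alpha z k in
  let Mm := M_minus alpha z k in
  let a := ca alpha k in
  let b := cb alpha k in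
  let r := rho alpha k in
  [/\ Mll alpha 0 0 z k
        = 1 + (a^* - b^* * Mp) * (a + b * Mm) / (r ^+ 2 * (Mp - Mm)),
      Mll alpha 1 1 z k = (1 - Mp * Mm) / (Mp - Mm),
      Mll alpha 0 1 z k
        = - 1 / (r * (Mp - Mm)) *
          (if oddz k then (1 - Mp) * (a^* - b^* * Mm)
           else (1 + Mp) * (a + b * Mm))
    & Mll alpha 1 0 z k
        = - 1 / (r * (Mp - Mm)) *
          (if oddz k then (1 + Mp) * (a + b * Mm)
           else (1 - Mp) * (a^* - b^* * Mm))].
Proof.
move=> Mp Mm a b r.
have r0 : r != 0 by exact: rho_neq0.
(* At [z = 0] both [1 - Mp] and [a + b * Mm] vanish, so the formulas reduce to the Kronecker
   delta. *)
have [zE|z0] := eqVneq z 0.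
  have alpha1 : alpha k - 1 != 0.
    rewrite subr_eq0; apply/eqP => e; have := halpha k.
    by rewrite e normc1 ltxx.
  have Mp1 : Mp = 1 by rewrite /Mp /M_plus zE eqxx.
  have MmE : Mm = (alpha k + 1) / (alpha k - 1) by rewrite /Mm /M_minus zE eqxx.
  have ab0 : a + b * Mm = 0 by rewrite MmE /a /b /ca /cb; field.
  have D0 : 1 - Mm != 0.
    rewrite MmE (_ : 1 - _ = - 2 / (alpha k - 1)); last by field.
    by rewrite mulf_neq0 ?oppr_eq0 ?pnatr_eq0 ?invr_eq0.
  rewrite zE !Mll_at0// Mp1 ab0; split.
  - by rewrite mulr0 mul0r addr0.
  - by rewrite mul1r divff.
  - by case: ifP => _; rewrite ?subrr ?mul0r !mulr0.
  - by case: ifP => _; rewrite ?subrr ?mul0r !mulr0.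
have hz2 : normc2 z != 1.
  have nz0 : 0 <= normc z by case: (z) => x y; exact: sqrtr_ge0.
  by rewrite /normc2 sqrf_eq1 negb_or hz gt_eqF// (lt_le_trans _ nz0)// oppr_lt0.
have D0 : Mm - Mp != 0 by rewrite subr_eq0 eq_sym; exact: M_plus_neq_minus.
have D0' : Mp - Mm != 0 by rewrite subr_eq0; exact: M_plus_neq_minus.
pose U M := @weyl_u R alpha z M k; pose V M := @weyl_v R alpha z M k.
have [up2 _] := M_plus_weyl halpha z0 hz2 k.
have [um2 _] := M_minus_weyl halpha z0 hz2 k.
have szp := weyl_szego halpha z0 Mp k.
have szm := weyl_szego halpha z0 Mm k.
have [upk vpk] : U Mp k = _ /\ V Mp k = _ := weyl_init halpha z0 Mp k.
have [umk vmk] : U Mm k = _ /\ V Mm k = _ := weyl_init halpha z0 Mm k.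
have Mw := Mll_wronskian halpha z0 hz2 szp szm up2 um2.
have k1 : k - 1 + 1 = k by rewrite subrK.
have k0 : k - 1 + 0 = k - 1 by rewrite addr0.
have a' : a^* = 1 + (alpha k)^* by rewrite /a /ca rmorphD /= conjC1.
have b' : b^* = 1 - (alpha k)^* by rewrite /b /cb rmorphB /= conjC1.
case: (boolP (oddz k)) upk vpk umk vmk => ok upk vpk umk vmk.
  (* The values of the Weyl solutions at [k - 1] follow from those at [k] by the backward step. *)
  have back M : U M k = z * (1 + M) -> V M k = M - 1 ->
      U M (k - 1) = z * (b^* * M - a^*) / r /\ V M (k - 1) = (a + b * M) / r.
    move=> uk vk; have [_ _] := szego_odd halpha _ _ _ (weyl_szego halpha z0 M k) ok.
    rewrite -/(U M) -/(V M) uk vk -/r => e1 e2; split; apply: (mulfI r0).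
      by rewrite e1 a' b'; field.
    by apply: (mulfI z0); rewrite mulrCA e2 /a /b /ca /cb; field.
  have [upk1 vpk1] := back _ upk vpk; have [umk1 vmk1] := back _ umk vmk.
  (* For odd [k] the cut must be next to the source and even: [k + 1] serves the source [k], and
     [k - 1] the source [k - 1]. Both Wronskians have the same value. *)
  have ek1 : ~~ oddz (k + 1) by rewrite oddzD1 ok.
  have ek0 : ~~ oddz (k - 1) by rewrite oddzB1 ok.
  have w0 : 2 * z ^+ 2 * (Mm - Mp) != 0 by rewrite !mulf_neq0 ?expf_neq0 ?pnatr_eq0.
  have wr : z * (rho alpha (k + 1) * (V Mp (k + 1) * V Mm (k + 1 - 1)
      - V Mm (k + 1) * V Mp (k + 1 - 1))) = 2 * z ^+ 2 * (Mm - Mp).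
    have [_ ep _ _] := szego_even halpha _ _ _ szp ek1.
    have [_ em _ _] := szego_even halpha _ _ _ szm ek1.
    rewrite -/(V Mp) -/(U Mp) addrK upk vpk in ep.
    rewrite -/(V Mm) -/(U Mm) addrK umk vmk in em.
    transitivity (z * (rho alpha (k + 1) * V Mp (k + 1) * V Mm k
      - rho alpha (k + 1) * V Mm (k + 1) * V Mp k)); first by rewrite addrK; ring.
    by rewrite ep em vpk vmk; ring.
  have wl : z * (rho alpha (k - 1) * (V Mp (k - 1) * V Mm (k - 1 - 1)
      - V Mm (k - 1) * V Mp (k - 1 - 1))) = 2 * z ^+ 2 * (Mm - Mp).
    have [_ _ _ ep] := szego_even halpha _ _ _ szp ek0.
    have [_ _ _ em] := szego_even halpha _ _ _ szm ek0.
    rewrite -/(V Mp) -/(U Mp) upk1 vpk1 in ep.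
    rewrite -/(V Mm) -/(U Mm) umk1 vmk1 in em.
    rewrite vpk1 vmk1.
    transitivity (z * ((a + b * Mp) / r * (rho alpha (k - 1) * V Mm (k - 1 - 1))
      - (a + b * Mm) / r * (rho alpha (k - 1) * V Mp (k - 1 - 1)))); first by ring.
    rewrite ep em; transitivity (2 * z ^+ 2 * (Mm - Mp) * (1 - alpha k * (alpha k)^*) / r ^+ 2).
      by rewrite a' b' /a /b /ca /cb; field.
    by rewrite -rho_sqr//; field.
  have lt1 : (k + 1 <= k) = false by apply/negP; lia.
  have lt2 : (k + 1 <= k - 1) = false by apply/negP; lia.
  have le1 : k - 1 <= k by lia.
  rewrite (Mw 0 0 k _ (k - 1) (k - 1) _ k0 k0 ek0 _ w0 wl) ?eqxx//.
  rewrite (Mw 1 1 k _ k (k + 1) _ k1 k1 ek1 _ w0 wr) ?addrK ?eqxx ?orbT//.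
  rewrite (Mw 0 1 k _ k (k + 1) _ k0 k1 ek1 _ w0 wr) ?addrK ?eqxx ?orbT//.
  rewrite (Mw 1 0 k _ (k - 1) (k - 1) _ k1 k0 ek0 _ w0 wl) ?eqxx//.
  rewrite lexx lt1 lt2 le1; rewrite /U /V in upk vpk umk vmk upk1 vpk1 umk1 vmk1.
  rewrite ?upk1 ?vpk1 ?umk1 ?vmk1 ?upk ?vpk ?umk ?vmk.
  by split; rewrite /= ?mulr1n ?mulr0n; field; rewrite ?r0 ?z0 ?D0 ?D0'.
have back M : U M k = M - 1 -> V M k = M + 1 ->
    U M (k - 1) = (a + b * M) / r /\ V M (k - 1) = (b^* * M - a^*) / r.
  move=> uk vk; have [_ _] := szego_even halpha _ _ _ (weyl_szego halpha z0 M k) ok.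
  rewrite -/(U M) -/(V M) uk vk -/r => e1 e2; split; apply: (mulfI r0).
    by rewrite e1 /a /b /ca /cb; field.
  by rewrite e2 a' b'; field.
have [upk1 vpk1] := back _ upk vpk; have [umk1 vmk1] := back _ umk vmk.
(* For even [k] the single cut at [k] serves both sources. *)
have w0 : 2 * z * (Mm - Mp) != 0 by rewrite !mulf_neq0 ?pnatr_eq0.
have wr : z * (rho alpha k * (V Mp k * V Mm (k - 1) - V Mm k * V Mp (k - 1)))
    = 2 * z * (Mm - Mp).
  by rewrite vpk vmk vpk1 vmk1 -/r a' b'; field.
have lt1 : (k <= k - 1) = false by apply/negP; lia.
rewrite (Mw 0 0 k _ (k - 1) k _ k0 k0 ok _ w0 wr) ?eqxx ?orbT//.
rewrite (Mw 1 1 k _ k k _ k1 k1 ok _ w0 wr) ?eqxx//.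
rewrite (Mw 0 1 k _ k k _ k0 k1 ok _ w0 wr) ?eqxx//.
rewrite (Mw 1 0 k _ (k - 1) k _ k1 k0 ok _ w0 wr) ?eqxx ?orbT//.
rewrite lexx lt1; rewrite /U /V in upk vpk umk vmk upk1 vpk1 umk1 vmk1.
  rewrite ?upk1 ?vpk1 ?umk1 ?vmk1 ?upk ?vpk ?umk ?vmk.
by split; rewrite /= ?mulr1n ?mulr0n; field; rewrite ?r0 ?z0 ?D0 ?D0'.
Qed.
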